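(* Let $n\ge 1$, $1\le m\le n$ and $0\le t\le m-1$ be integers, and let $Q=B_n(m,t)$ be the flag-shaped set of positions of an $n\times n$ matrix, of cardinality $n+t(n-m)$. Then $Q$ is a minimum blocker of all $n\times n$ $123$-avoiding permutation matrices: $Q$ is a blocker, and for every position $q\in Q$ the set $Q\setminus\{q\}$ is not a blocker.
   Context: A permutation matrix $P$ contains a $123$-pattern if the $3\times 3$ identity matrix $I_3$ is a submatrix of $P$; otherwise $P$ is $123$-avoiding. A set $Q$ of positions of an $n\times n$ matrix is a blocker if every $n\times n$ $123$-avoiding permutation matrix has a $1$ in some position of $Q$. A blocker is called minimum (in this paper's terminology) if removing any single element from it yields a set that is no longer a blocker. For integers $1\le m\le n$, $0\le t\le m-1$, $B_n(m,t)$ is the union of $\{(i,m): 1\le i\le n-t\}$ and $\{(i,j): 1\le i\le n-m+1,\ m-t\le j\le m-1\}$, positions written as (row, column). *)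

(* Defs.v *)
From HB Require Import structures.
From mathcomp Require Export all_boot all_order all_fingroup all_algebra.

Set Implicit Arguments.
Unset Strict Implicit.
Unset Printing Implicit Defensive.

Definition contains123 (n : nat) (P : 'M[int]_n) : Prop :=
  exists f g : 'I_3 -> 'I_n,
    [/\ {homo f : i j / (i < j)%N}, {homo g : i j / (i < j)%N}
      & mxsub f g P = 1%:M%R].

Definition avoids123 (n : nat) (P : 'M[int]_n) : Prop := ~ contains123 P.

Definition blocker (n : nat) (Q : {set 'I_n * 'I_n}) : Prop :=
  forall P : 'M[int]_n, is_perm_mx P -> avoids123 P ->
    exists2 q, q \in Q & P q.1 q.2 = 1%R.

(* "Minimum" here means minimal under inclusion, not of least cardinality. *)
Definition minimum_blocker (n : nat) (Q : {set 'I_n * 'I_n}) : Prop :=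
  blocker Q /\ forall q, q \in Q -> ~ blocker (Q :\ q).

(* Positions are (row, column). The parameters m and t refer to rows and columns
   numbered from 1, so the position p : 'I_n * 'I_n has row p.1.+1 and column
   p.2.+1. *)
Definition flag (n m t : nat) : {set 'I_n * 'I_n} :=
  [set p : 'I_n * 'I_n | (1 <= p.1.+1 <= n - t) && (p.2.+1 == m)]
  :|: [set p : 'I_n * 'I_n | (1 <= p.1.+1 <= n - m + 1) && (m - t <= p.2.+1 <= m - 1)].

(* Main.v *)
Require Import Defs.
From mathcomp Require Import zify.

Set Implicit Arguments.
Unset Strict Implicit.
Unset Printing Implicit Defensive.

(** Count in two stages to see that the flag is a blocker. If a permutation
    misses it, the [t + 1] columns [m - t, ..., m] cannot all have their entry in
    the last [t] rows, so one of the first [t] has its entry strictly above, and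
    to the left of, the entry of column [m]. The first [n - m + 1] rows all lie
    above that entry and have none in the columns of the flag; they cannot all
    have theirs in the last [n - m] columns, so one completes a 123-pattern.

    For minimality at [q], put an entry at [q], fill the other columns
    [m - t, ..., m] decreasingly with the last [t] rows, and fill the remaining
    columns decreasingly with the remaining rows. *)

Lemma card_ord_interval (n a b : nat) :
  b <= n -> #|[set i : 'I_n | a <= i < b]| = b - a.
Proof.
move=> le_bn; rewrite -sum1_card -[RHS]muln1 -sum_nat_const_nat.
rewrite big_geq_mkord (big_ord_widen_cond n (fun i => a <= i) (fun=> 1)) //.
by apply: eq_bigl => i; rewrite inE.
Qed.

(** An increasing triple suffices: the off-diagonal zeros of the submatrix come for free, since
    [s \o f] is strictly increasing. *)
Lemma contains123_perm_mxP (n : nat) (s : 'S_n) :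
  contains123 (perm_mx s : 'M[int]_n) <->
  exists a b c : 'I_n, [/\ a < b, b < c, s a < s b & s b < s c].
Proof.
split=> [[f [g [f_homo g_homo /matrixP fgP]]]|[a [b [c [ab bc sab sbc]]]]].
  have sf k : s (f k) = g k.
    apply/eqP; move: (fgP k k); rewrite !mxE eqxx.
    by case: (s (f k) == g k).
  exists (f (inord 0)), (f (inord 1)), (f (inord 2)).
  by rewrite !sf; split; do ?[apply: f_homo | apply: g_homo]; rewrite !inordK.
pose f := tnth [tuple a; b; c].
have homo3 (h : 'I_3 -> 'I_n) : h (inord 0) < h (inord 1) ->
    h (inord 1) < h (inord 2) -> {homo h : i j / (i < j)%N}.
  move=> h01 h12 i j.
  rewrite -[i]inord_val -[j]inord_val !inordK //.
  case: i j => [[|[|[|i]]] hi] [[|[|[|j]]] hj] //= _.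
  exact: ltn_trans h01 h12.
exists f, (s \o f).
have s_homo : {homo s \o f : i j / (i < j)%N}.
  by apply: homo3; rewrite /= /f !(tnth_nth a) !inordK.
split=> //; first by apply: homo3; rewrite /f !(tnth_nth a) !inordK.
apply/matrixP=> i j; rewrite !mxE.
suff -> : (s (f i) == s (f j)) = (i == j) by [].
apply/eqP/eqP=> [eq_sf|-> //]; apply/val_inj.
by case: (ltngtP i j) => // /s_homo /=; rewrite eq_sf ltnn.
Qed.

Lemma perm_mx_eq1 (n : nat) (s : 'S_n) (i j : 'I_n) :
  (perm_mx s : 'M[int]_n) i j = 1%R <-> s i = j.
Proof. by rewrite !mxE; split=> [|/eqP->//]; case: eqP. Qed.

Lemma mem_flag (n m t : nat) (p : 'I_n * 'I_n) : 0 < m ->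
  (p \in flag n m t) =
  (p.1 < n - t) && (p.2 == m.-1 :> nat)
  || (p.1 <= n - m) && (m.-1 - t <= p.2 < m.-1).
Proof. move=> m_gt0; rewrite !inE /=; apply/idP/idP; lia. Qed.

Lemma card_flag (n m t : nat) : 0 < m <= n -> t < m ->
  #|flag n m t| = n + t * (n - m).
Proof.
move=> hm ht.
pose I a b := [set i : 'I_n | a <= i < b].
(* Two disjoint rectangles, of sizes [n - t] and [(n - m + 1) * t]. *)
have -> : flag n m t = setX (I 0 (n - t)) (I m.-1 m)
    :|: setX (I 0 (n - m).+1) (I (m.-1 - t) m.-1).
  apply/setP=> -[x y]; rewrite mem_flag; last by lia.
  by rewrite in_setU !in_setX !inE /=; apply/idP/idP; lia.
rewrite cardsU (_ : _ :&: _ = set0); last first.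
  by apply/setP=> -[x y]; rewrite in_setI !in_setX !inE; lia.
rewrite cards0 !cardsX !card_ord_interval; nia.
Qed.

Lemma exists_perm_notin (n : nat) (s : 'S_n) (A B : {set 'I_n}) :
  #|B| < #|A| -> exists2 x, x \in A & s x \notin B.
Proof.
move=> ltBA; apply/exists_inP; apply: contraLR ltBA => /exists_inPn sAB.
rewrite -leqNgt -(card_imset _ (@perm_inj _ s)).
by apply/subset_leq_card/subsetP=> _ /imsetP[x /sAB /negPn sxB ->].
Qed.

Lemma flag_blocker (n m t : nat) : 0 < m <= n -> t < m ->
  blocker (flag n m t).
Proof.
move=> hm ht P /existsP[s /eqP ->] avP; case: (boolP [exists r, (r, s r) \in flag n m t]).
  by case/existsP=> r rQ; exists (r, s r) => //; apply/perm_mx_eq1.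
move/existsPn=> noQ; case: avP; apply/contains123_perm_mxP.
have {}noQ (r : 'I_n) : ~~ ((r < n - t) && (s r == m.-1 :> nat)
  || (r <= n - m) && (m.-1 - t <= s r < m.-1)).
  by have := noQ r; rewrite mem_flag //; case/andP: hm.
have lt_m1n : m.-1 < n by lia.
pose c := s^-1%g (Ordinal lt_m1n).
have sc : s c = m.-1 :> nat by rewrite permKV.
have [|j] := @exists_perm_notin _ s^-1%g [set j : 'I_n | m.-1 - t <= j < m]
  [set i : 'I_n | n - t <= i < n].
  by rewrite !card_ord_interval; lia.
rewrite !inE => hj; set b := s^-1%g j => hb.
have sb : s b = j by rewrite permKV.
have [|a] := @exists_perm_notin _ s [set i : 'I_n | 0 <= i < (n - m).+1]
  [set j : 'I_n | m <= j < n].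
  by rewrite !card_ord_interval; lia.
rewrite !inE => ha hsa.
(* Missing the flag forces [n - t <= c], then [j < m.-1] and [n - m < b], and finally
   [s a < m.-1 - t]. *)
have := (noQ a, noQ b, noQ c); rewrite sc sb => -[[na nb] nc].
have := (ltn_ord (s a), ltn_ord b, ltn_ord j) => -[[ltsa ltb] ltj].
exists a, b, c; rewrite sc sb; split; lia.
Qed.

(* All indices start from 0, and the value is the row of the entry in column
   [c]: here [m] is the last column of the flag and [(i, j)] is the position [q].
   In the last branch [r] is the row that column [c] would get if no row were
   reserved for column [j], and the test makes room for row [i]. *)
Definition witness (n m t i j c : nat) : nat :=
  if c == j then i
  else if m - t <= c <= m then n - (c < j) - (c - (m - t))
  else let r := n - c - (if c < m then t.+1 else 0) in if i < r then r else r.-1.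

(** Each case ties the row [w] to the column by an addition-only equation, which leaves the later
    lemmas to linear arithmetic. *)
Lemma witnessP (n m t i j c : nat) :
  m < n -> t <= m -> m - t <= j <= m ->
  i < (if j == m then n - t else n - m) -> c < n ->
  let w := witness n m t i j c in
  [\/ c = j /\ w = i,
      m - t <= c < j /\ w + c + t + 1 = n + m,
      j < c <= m /\ w + c + t = n + m
    | [\/ c < m - t /\ (i < w /\ w + c + t + 1 = n),
          c < m - t /\ (w < i /\ w + c + t + 2 = n),
          m < c /\ (i < w /\ w + c = n)
        | m < c /\ (w < i /\ w + c + 1 = n)]].
Proof.
move=> h1 h2 h3 h4 h5; rewrite /witness.
case: (c =P j) => [->|/eqP ne]; first by constructor 1.
case: ifP => [|/negbT] h6 /=.
  by have [lt|gt|eq] := ltngtP c j; [constructor 2|constructor 3|]; lia.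
constructor 4; case: (ltnP c m) => h7 /=.
  case: ifP => h8; [constructor 1|constructor 2]; move: h4; case: ifP; lia.
case: ifP => h8; [constructor 3|constructor 4]; move: h4; case: ifP; lia.
Qed.

Lemma witness_lt (n m t i j c : nat) :
  m < n -> t <= m -> m - t <= j <= m ->
  i < (if j == m then n - t else n - m) ->
  c < n -> witness n m t i j c < n.
Proof.
move=> h1 h2 h3 h4 hc; have := witnessP h1 h2 h3 h4 hc; move=> /=.
by move: h4; case: ifP => ? ? [||| []] [? ?]; lia.
Qed.

Lemma witness_inj (n m t i j c d : nat) :
  m < n -> t <= m -> m - t <= j <= m ->
  i < (if j == m then n - t else n - m) ->
  c < n -> d < n -> witness n m t i j c = witness n m t i j d -> c = d.
Proof.
move=> h1 h2 h3 h4 hc hd.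
have := witnessP h1 h2 h3 h4 hc; have := witnessP h1 h2 h3 h4 hd; move=> /=.
move: (witness _ _ _ _ _ c) (witness _ _ _ _ _ d) => x y.
move: h4; case: ifP => ? ? [||| []] [? ?] [||| []] [? ?] ?; lia.
Qed.

(** The entries form three decreasing chains: [(i, j)] alone, the other flag columns, the remaining
    columns. A pattern takes one from each. The flag columns are consecutive and their chain has the
    lowest rows, so the pattern would start left of the flag, pass through [(i, j)] and end in a
    flag column. Then [j < m], so [i < n - m], but no entry left of the flag lies above row
    [n - m - 1]. *)
Lemma witness_avoids (n m t i j a b c : nat) :
  m < n -> t <= m -> m - t <= j <= m ->
  i < (if j == m then n - t else n - m) ->
  a < b -> b < c -> c < n ->
  witness n m t i j a < witness n m t i j b ->
  witness n m t i j b < witness n m t i j c -> False.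
Proof.
move=> h1 h2 h3 h4 ab bc hc; have hb := ltn_trans bc hc; have ha := ltn_trans ab hb.
have := witnessP h1 h2 h3 h4 ha; have := witnessP h1 h2 h3 h4 hb.
have := witnessP h1 h2 h3 h4 hc; move=> /=.
move: (witness _ _ _ _ _ a) (witness _ _ _ _ _ b) (witness _ _ _ _ _ c) => x y z.
move=> hz hy hx xy yz; move: h4 hx hy.
case: ifP => ? ? [||| []] [? ?] [||| []] [? ?]; (try lia); case: hz => [||| []] [? ?]; lia.
Qed.

Lemma witness_inner (n m t i j c : nat) :
  m < n -> t <= m -> m - t <= j <= m ->
  m - t <= c <= m -> c != j -> n - t <= witness n m t i j c.
Proof. by rewrite /witness; do ?case: ifP; lia. Qed.

Lemma flag_minimal (n m t : nat) (q : 'I_n * 'I_n) : 0 < m <= n -> t < m ->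
  q \in flag n m t -> ~ blocker (flag n m t :\ q).
Proof.
case: q => i j hm ht; rewrite mem_flag /=; last by lia.
move=> qQ.
have lt_mn : m.-1 < n by lia.
have le_tm : t <= m.-1 by lia.
have hj : m.-1 - t <= j <= m.-1 by lia.
have hi : i < (if j == m.-1 :> nat then n - t else n - m.-1).
  by case: eqP; lia.
pose f (c : 'I_n) := Ordinal (witness_lt lt_mn le_tm hj hi (ltn_ord c)).
have f_inj : injective f.
  move=> c d /(congr1 val) /= /(witness_inj lt_mn le_tm hj hi) eq_cd.
  exact/val_inj/eq_cd.
pose s := perm f_inj.
(* [f] sends columns to rows and [perm_mx] expects rows to columns, hence the inverse. *)
move=> /(_ (perm_mx s^-1)) [||[r c]].
- by apply/existsP; exists s^-1%g.
- move=> /contains123_perm_mxP[a [b [c [ab bc sab sbc]]]].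
  have sK x : val x = witness n m.-1 t i j (s^-1%g x).
    by rewrite -{1}[x](permKV s) permE.
  move: ab bc; rewrite (sK a) (sK b) (sK c).
  exact: (witness_avoids lt_mn le_tm hj hi sab sbc).
- rewrite in_setD1 mem_flag /=; last by lia.
  move=> /andP[neq rcQ] /perm_mx_eq1 src.
  have {src} r_def : r = f c by rewrite -src -(permE f_inj) permKV.
  (* The only entry in column [j] is [q], which was removed. *)
  have neq_cj : c != j :> nat.
    apply: contra neq => /eqP/val_inj c_j; apply/eqP; congr pair => //.
    by apply/val_inj; rewrite r_def c_j /= /witness eqxx.
  (* The last [t] rows do not meet the flag. *)
  have hr : n - t <= r.
    rewrite r_def /=; apply: (witness_inner _ lt_mn le_tm hj) => //; lia.
  by lia.
Qed.

Theorem theorem2p3 (n m t : nat) (hn : 1 <= n) (hm : 1 <= m <= n)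
    (ht : 0 <= t <= m - 1) :
  #|flag n m t| = n + t * (n - m) /\ minimum_blocker (flag n m t).
Proof.
have lt_tm : t < m by lia.
split; first exact: card_flag.
split; first exact: flag_blocker.
by move=> q qQ; apply: flag_minimal.
Qed.
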